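(* Let $H$ be a complex Hilbert space and let $A_n\in B(H)$ $(n\ge1)$ be invertible operators with $A_n\to A$ in operator norm, where $A\in B(H)$, $A\neq0$, is singular (not necessarily positive). Then $\kappa(A_n)\to+\infty$, and hence $\operatorname{OLC}(A_n)\to+\infty=\operatorname{OLC}(A)$.
   Context: $B(H)$ is the algebra of bounded operators on $H$ with operator norm $\|\cdot\|$. Singular means not invertible in $B(H)$. For invertible $A$, $\kappa(A):=\|A\|\,\|A^{-1}\|$ and $\operatorname{OLC}(A):=\tfrac12\ln\kappa(A)$. By convention $\operatorname{OLC}(A):=+\infty$ for singular nonzero $A$. *)

(* Defs.v *)
From HB Require Import structures.
From mathcomp Require Import all_boot all_order all_algebra.
From mathcomp Require Import complex.
From mathcomp Require Import all_classical all_reals all_analysis.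

Set Implicit Arguments.
Unset Strict Implicit.
Unset Printing Implicit Defensive.

Import Order.TTheory GRing.Theory Num.Theory.
Import numFieldNormedType.Exports.

Local Open Scope classical_set_scope.
Local Open Scope ring_scope.
Local Open Scope complex_scope.

(* Complex Hilbert spaces: the completeness of the norm comes from
   [completeNormedModType], whose norm takes its (real, nonnegative) values in
   the scalar field [R[i]]. The inner product is linear in its first
   argument. *)
HB.mixin Record CompleteNormedModule_isHilbert (R : realType) H
    & CompleteNormedModule R[i] H := {
  hdot : {dot H for Num.conj} ;
  hdotxx : forall x : H, hdot x x = `|x| ^+ 2
}.

#[short(type="hilbertType")]
HB.structure Definition Hilbert (R : realType) :=
  {H of CompleteNormedModule R[i] H & CompleteNormedModule_isHilbert R H}.

Section BoundedOperators.
Context {R : realType} {H : hilbertType R}.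

(* The norm of H read in R instead of R[i]. *)
Definition hnorm (x : H) : R := complex.Re `|x|.

Lemma hnormE (x : H) : `|x| = (hnorm x)%:C.
Proof. by rewrite /hnorm RRe_real// ger0_real. Qed.

Lemma hnorm_ge0 (x : H) : 0 <= hnorm x.
Proof. by rewrite -ler0c -hnormE. Qed.

Lemma hnormD (x y : H) : hnorm (x + y) <= hnorm x + hnorm y.
Proof. by rewrite -lecR rmorphD/= -!hnormE ler_normD. Qed.

Lemma hnormN (x : H) : hnorm (- x) = hnorm x.
Proof. by rewrite /hnorm normrN. Qed.

Definition bounded_linear (f : H -> H) : Prop :=
  linear f /\ exists M : R, forall x, hnorm (f x) <= M * hnorm x.

Definition bounded_linear_pred : {pred H -> H} :=
  fun f => `[< bounded_linear f >].

Lemma bounded_linear_pred_zmod_closed : zmod_closed bounded_linear_pred.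
Proof.
split=> [|f g].
  apply/asboolP; split=> [a x y|]; first by rewrite scaler0 addr0.
  by exists 0 => x; rewrite mul0r /hnorm normr0.
move=> /asboolP[flin [M fM]] /asboolP[glin [N gN]]; apply/asboolP; split.
  move=> a x y; rewrite !fctE flin glin opprD addrACA scalerBr//.
exists (M + N) => x; rewrite !fctE mulrDl (le_trans (hnormD _ _))//.
by rewrite hnormN lerD.
Qed.

HB.instance Definition _ :=
  GRing.isZmodClosed.Build (H -> H) bounded_linear_pred
    bounded_linear_pred_zmod_closed.

End BoundedOperators.

Record boundedOp (R : realType) (H : hilbertType R) := BoundedOp {
  boundedOp_fun :> H -> H ;
  boundedOp_subproof : boundedOp_fun \in bounded_linear_pred }.

Notation "''B' ( H )" := (boundedOp H) (format "''B' ( H )") : type_scope.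

Section BoundedOperatorTheory.
Context {R : realType} {H : hilbertType R}.

HB.instance Definition _ := [isSub of 'B(H) for @boundedOp_fun R H].
HB.instance Definition _ := [Choice of 'B(H) by <:].
HB.instance Definition _ := [SubChoice_isSubZmodule of 'B(H) by <:].

Lemma boundedOpP (A : 'B(H)) : bounded_linear A.
Proof. by apply/asboolP; exact: (boundedOp_subproof A). Qed.

HB.instance Definition _ (A : 'B(H)) :=
  GRing.isLinear.Build R[i] H H *:%R A (boundedOpP A).1.

Definition opnorm (A : 'B(H)) : R :=
  sup [set hnorm (A x) | x in [set x : H | hnorm x <= 1]].

Definition is_inverse (A B : 'B(H)) : Prop :=
  (A : H -> H) \o B = id /\ (B : H -> H) \o A = id.

Definition invertible (A : 'B(H)) : Prop := exists B : 'B(H), is_inverse A B.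

Definition singular (A : 'B(H)) : Prop := ~ invertible A.

(* The inverse of [A] in B(H); it is [A] itself when [A] is singular. *)
Definition opinv (A : 'B(H)) : 'B(H) := xget A (is_inverse A).

(* Only meaningful when [A] is invertible. *)
Definition kappa (A : 'B(H)) : R := opnorm A * opnorm (opinv A).

(* Only meaningful when [A] is invertible or nonzero. *)
Definition OLC (A : 'B(H)) : \bar R :=
  if `[< invertible A >] then (2^-1 * ln (kappa A))%:E else +oo%E.

End BoundedOperatorTheory.

(* Main.v *)
(* If B is inverse to C and |B| |C - A| < 1, then x |-> x + B (y - A x) is a
   contraction whose fixed points solve A x = y, so A is invertible. For a
   singular A this forces |A_n^-1| >= 1 / |A_n - A| --> +oo, while |A_n| stays
   above |A| / 2 > 0. *)
Require Import Defs.
From mathcomp Require Import all_boot all_order all_algebra.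
From mathcomp Require Import complex.
From mathcomp Require Import all_classical all_reals all_analysis.
From mathcomp Require Import lra.

Set Implicit Arguments.
Unset Strict Implicit.
Unset Printing Implicit Defensive.

Import Order.TTheory GRing.Theory Num.Theory.
Import numFieldNormedType.Exports.

Local Open Scope classical_set_scope.
Local Open Scope ring_scope.

Section HilbertNorm.
Context {R : realType} {H : hilbertType R}.
Implicit Types x y : H.

Lemma hnorm0 : hnorm (0 : H) = 0.
Proof. by rewrite /hnorm normr0. Qed.

Lemma hnorm0_eq0 x : hnorm x = 0 -> x = 0.
Proof. by move=> x0; apply/normr0_eq0; rewrite hnormE x0. Qed.

Lemma hnormZ (r : R) x : hnorm (r%:C%C *: x) = `|r| * hnorm x.
Proof.
rewrite /hnorm normrZ (hnormE x) normc_def/= expr0n/= addr0 sqrtr_sqr.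
by rewrite mulr0 subr0.
Qed.

Lemma hnorm_sum (I : Type) (s : seq I) (P : pred I) (F : I -> H) :
  hnorm (\sum_(i <- s | P i) F i) <= \sum_(i <- s | P i) hnorm (F i).
Proof.
elim/big_ind2 : _ => [|a x b y xa yb|//]; first by rewrite hnorm0.
by rewrite (le_trans (Defs.hnormD _ _)) ?lerD.
Qed.

(** Comparable elements of [R[i]] share their imaginary part, so a positive one is real. This turns
    the [R[i]]-valued tolerances of the topology of [H] into real ones. *)
Lemma pos_complexE (e : R[i]) : 0 < e -> e = (complex.Re e)%:C%C.
Proof. by move=> e0; rewrite RRe_real// ger0_real// ltW. Qed.

(* Banach's theorem in the library is stated for real scalars only. *)
Lemma contraction_fixpoint (f : H -> H) (q : R) : 0 <= q < 1 ->
  (forall x y, hnorm (f x - f y) <= q * hnorm (x - y)) ->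
  exists x, f x = x.
Proof.
move=> /andP[q0 q1] fq; pose v : H ^nat := fun k => iter k f 0.
(* Picard iteration from [0]: the first step has length [hnorm (f 0)], and each later one shrinks by
   the factor [q]. *)
have step k : hnorm (v k.+1 - v k) <= geometric (hnorm (f 0)) q k.
  elim: k => [|k ih]; first by rewrite /= expr0 mulr1 subr0.
  by rewrite (le_trans (fq _ _))//= exprS mulrCA ler_wpM2l.
(* The increments are dominated by a convergent geometric series, so their series is Cauchy and
   converges by completeness of [H]. *)
have cvg_step : cvgn (series (telescope v)).
  apply/cauchy_cvgP/cauchy_seriesP => e e0.
  have /cauchy_cvgP/cauchy_seriesP geo :
      cvgn (series (geometric (hnorm (f 0)) q)).
    by apply: is_cvg_geometric_series; rewrite ger0_norm.
  have e0' : 0 < complex.Re e by rewrite -(ltcR 0) -pos_complexE.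
  have := geo _ e0'; apply: filterS => -[m n]/= mn.
  rewrite (pos_complexE e0) hnormE ltcR (le_lt_trans (hnorm_sum _ _ _))//.
  apply: le_lt_trans mn; rewrite (le_trans _ (ler_norm _))//.
  by apply: ler_sum_nat => k _; exact: step.
have [l vl] : exists l : H, v @ \oo --> l.
  exists (v 0%N + limn (series (telescope v))).
  under eq_cvg do rewrite eq_sum_telescope.
  by apply: cvgD cvg_step; exact: cvg_cst.
(* Compare [f l] and [l] through [v n.+1 = f (v n)]: each of the two distances is below [e / 2] for
   large [n]. *)
exists l; apply/subr0_eq/hnorm0_eq0/eqP; rewrite eq_le hnorm_ge0 andbT.
apply/ler_addgt0Pl => e e0; rewrite addr0.
have e2 : (0 : R[i]) < (e / 2)%:C%C by rewrite (ltcR 0) divr_gt0.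
have vl1 : v n.+1 @[n --> \oo] --> l.
  by rewrite (cvg_shiftS v).
near \oo => n.
have ln : hnorm (l - v n) < e / 2.
  rewrite -ltcR -hnormE; near: n.
  by move/cvgrPdist_lt : vl; apply.
have ln1 : hnorm (v n.+1 - l) < e / 2.
  rewrite -ltcR -hnormE distrC; near: n.
  by move/cvgrPdist_lt : vl1; apply.
rewrite -(subrK (v n.+1) (f l)) -addrA (le_trans (Defs.hnormD _ _))//.
rewrite [leRHS]splitr lerD ?(ltW ln1)// (le_trans (fq _ _))//.
by rewrite (le_trans _ (ltW ln))// ler_piMl ?hnorm_ge0 ?ltW.
Unshelve. all: by end_near. Qed.

End HilbertNorm.

Section OperatorNorm.
Context {R : realType} {H : hilbertType R}.
Implicit Types A B C : 'B(H).

Let has_sup_opnorm A :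
  has_sup [set hnorm (A x) | x in [set x : H | hnorm x <= 1]].
Proof.
have [_ [M AM]] := boundedOpP A.
split; first by exists (hnorm (A 0)), 0 => //=; rewrite hnorm0 ler01.
exists `|M| => _ [x /= x1 <-]; rewrite (le_trans (AM x))//.
rewrite (le_trans (ler_wpM2r (hnorm_ge0 x) (ler_norm M)))//.
by rewrite ler_piMr.
Qed.

Lemma opnorm_ge0 A : 0 <= opnorm A.
Proof.
apply: le_trans (ub_le_sup (has_sup_opnorm A).2 _).
  exact: (hnorm_ge0 (A 0)).
by exists 0 => //=; rewrite hnorm0 ler01.
Qed.

(** Rescale [x] to a unit vector; the zero vector is treated apart because it cannot be
    normalised. *)
Lemma opnorm_bound A x : hnorm (A x) <= opnorm A * hnorm x.
Proof.
have [x0|x0] := eqVneq (hnorm x) 0.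
  by rewrite (hnorm0_eq0 x0) linear0 hnorm0 mulr0.
have xp : 0 < hnorm x by rewrite lt_neqAle eq_sym x0 hnorm_ge0.
rewrite -ler_pdivrMr// mulrC.
have <- : hnorm (A ((hnorm x)^-1%:C%C *: x)) = (hnorm x)^-1 * hnorm (A x).
  by rewrite linearZ/= hnormZ ger0_norm// invr_ge0 ltW.
apply: (ub_le_sup (has_sup_opnorm A).2); exists ((hnorm x)^-1%:C%C *: x) => //=.
by rewrite hnormZ ger0_norm ?invr_ge0 ?mulVf// ltW.
Qed.

Lemma opnorm_le A (M : R) : 0 <= M ->
  (forall x, hnorm (A x) <= M * hnorm x) -> opnorm A <= M.
Proof.
move=> M0 AM; apply: ge_sup (has_sup_opnorm A).1 _ => _ [x /= x1 <-].
by rewrite (le_trans (AM x))// ler_piMr.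
Qed.

Lemma opnorm_gt0 A : A != 0 -> 0 < opnorm A.
Proof.
apply: contraNT; rewrite -leNgt => A0; apply/eqP/val_inj/funext => x /=.
apply/hnorm0_eq0/eqP; rewrite eq_le hnorm_ge0 andbT.
by rewrite (le_trans (opnorm_bound A x))// mulr_le0_ge0// hnorm_ge0.
Qed.

Lemma opnorm_distl A B : opnorm A <= opnorm B + opnorm (B - A).
Proof.
apply: opnorm_le => [|x]; first by rewrite addr_ge0 ?opnorm_ge0.
have -> : A x = B x - (B - A) x by rewrite /= opprB addrC subrK.
by rewrite (le_trans (Defs.hnormD _ _))// Defs.hnormN mulrDl lerD ?opnorm_bound.
Qed.

Lemma invertible_perturbation A B C : is_inverse C B ->
  opnorm B * opnorm (C - A) < 1 -> invertible A.
Proof.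
move=> [CB BC] q1.
have CK y : C (B y) = y by exact: (congr1 (@^~ y) CB).
have BK x : B (C x) = x by exact: (congr1 (@^~ x) BC).
have q0 : 0 <= opnorm B * opnorm (C - A) by rewrite mulr_ge0 ?opnorm_ge0.
set q := opnorm B * opnorm (C - A) in q0 q1.
(* Since [B (C x) = x], the vector on the left is [x - B (A x)], the linear part of the map iterated
   below; hence its contraction constant is [q]. *)
have BCA x : hnorm (B (C x - A x)) <= q * hnorm x.
  rewrite (le_trans (opnorm_bound _ _))// -mulrA ler_wpM2l ?opnorm_ge0//.
  exact: (opnorm_bound (C - A)).
have Asurj y : exists x, A x = y.
  have [||x fx] := @contraction_fixpoint _ _ (fun x => x + B (y - A x)) q.
  - by rewrite q0 q1.
  - move=> x x'; apply: le_trans (BCA (x - x')).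
    rewrite !linearB/= !BK le_eqVlt; apply/orP; left; apply/eqP; congr hnorm.
    rewrite opprD opprB addrACA; congr (_ + _).
    by rewrite addrC subrKA opprK addrC.
  (* A fixed point gives [B (y - A x) = 0], and applying [C] removes [B]. *)
  - exists x; apply/esym/subr0_eq.
    rewrite -(CK (y - A x)) (_ : B (y - A x) = 0) ?linear0//.
    by apply: (addrI x); rewrite fx addr0.
(* Split [x = B (C x)] as [B (C x - A x) + B (A x)] and absorb the first term, at most
   [q * hnorm x]. This bound yields both injectivity of [A] and boundedness of its inverse. *)
have Abelow x : hnorm x <= opnorm B / (1 - q) * hnorm (A x).
  rewrite mulrAC ler_pdivlMr ?subr_gt0// mulrBr mulr1 lerBlDr.
  rewrite -[in leLHS](BK x) -(subrK (A x) (C x)) linearD/=.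
  by rewrite addrC (le_trans (Defs.hnormD _ _))// lerD ?opnorm_bound// mulrC.
have [g gK] := choice Asurj.
have Ainj x x' : A x = A x' -> x = x'.
  move=> /eqP; rewrite -subr_eq0 -linearB/= => /eqP Axx'.
  apply/subr0_eq/hnorm0_eq0/eqP; rewrite eq_le hnorm_ge0 andbT.
  by rewrite (le_trans (Abelow _))// Axx' hnorm0 mulr0.
(* Linearity of the chosen right inverse [g] follows from that of [A] by injectivity. *)
have gP : g \in bounded_linear_pred.
  apply/asboolP; split.
    by move=> a x y; apply: Ainj; rewrite linearP/= !gK.
  by exists (opnorm B / (1 - q)) => y; rewrite -[in leRHS](gK y).
exists (BoundedOp gP); split; apply/funext => x /=; first exact: gK.
by apply: Ainj; rewrite gK.
Qed.

Lemma opinvP A : invertible A -> is_inverse A (opinv A).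
Proof. by move=> [B AB]; exact: xgetPex (ex_intro _ B AB). Qed.

(** Contrapositive of [invertible_perturbation]. The product form avoids dividing by a distance not
    yet known to be nonzero. *)
Lemma singular_opinv_ge A C : singular A -> invertible C ->
  1 <= opnorm (opinv C) * opnorm (C - A).
Proof.
move=> sA /opinvP CI; rewrite leNgt; apply/negP => lt1.
exact/sA/(invertible_perturbation CI).
Qed.

End OperatorNorm.

Theorem proposition3p3 (R : realType) (H : hilbertType R)
    (A_ : nat -> 'B(H)) (A : 'B(H))
    (A_inv : forall n, (1 <= n)%N -> invertible (A_ n))
    (A_cvg : opnorm (A_ n - A) @[n --> \oo] --> (0 : R))
    (A_neq0 : A != 0)
    (A_singular : singular A) :
  kappa (A_ n) @[n --> \oo] --> +oo /\
  (OLC (A_ n) @[n --> \oo] --> +oo%E /\ OLC A = +oo%E).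
Proof.
have a0 := opnorm_gt0 A_neq0.
have lt_dist e : 0 < e -> \forall k \near \oo, opnorm (A_ k - A) < e.
  move=> e0; move/cvgrPdist_lt : A_cvg => /(_ e e0); apply: filterS => k.
  by rewrite sub0r normrN ger0_norm ?opnorm_ge0.
have kappay : kappa (A_ n) @[n --> \oo] --> +oo.
  apply/cvgryPge => M.
  (* Replacing [M] by [Num.max M 1] gives a positive divisor even when [M <= 0]. *)
  have M0 : 0 < Num.max M 1 by rewrite lt_max ltr01 orbT.
  near=> n.
  have n1 : (1 <= n)%N by near: n; exact: nbhs_infty_ge.
  have d1 : opnorm (A_ n - A) < opnorm A / 2.
    by near: n; apply: lt_dist; rewrite divr_gt0.
  have d2 : opnorm (A_ n - A) < opnorm A / 2 / Num.max M 1.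
    by near: n; apply: lt_dist; rewrite !divr_gt0.
  have Bd := singular_opinv_ge A_singular (A_inv _ n1).
  have d_gt0 : 0 < opnorm (A_ n - A).
    rewrite lt_neqAle opnorm_ge0 andbT eq_sym; apply: contraTneq Bd => ->.
    by rewrite mulr0 -ltNge ltr01.
  (* With [d = opnorm (A_ n - A)], the chain is [M * d <= opnorm A / 2 <= opnorm (A_ n) <= kappa (A_
     n) * d], using [d2], [d1] and [Bd] in turn. *)
  rewrite -(ler_pM2r d_gt0) (@le_trans _ _ (opnorm A / 2))//.
    rewrite ltr_pdivlMr// in d2; apply: le_trans (ltW d2).
    by rewrite mulrC ler_pM2l// le_max lexx.
  rewrite /kappa -mulrA (@le_trans _ _ (opnorm (A_ n)))//.
    have := opnorm_distl A (A_ n); lra.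
  by rewrite ler_peMr ?opnorm_ge0.
split=> //; split; last by rewrite /OLC asboolF.
apply/cvgeyPge => M; near=> n.
have n1 : (1 <= n)%N by near: n; exact: nbhs_infty_ge.
(* The threshold is the one for which half the logarithm of [kappa] reaches [M]. *)
have kM : expR (2 * M) <= kappa (A_ n).
  by near: n; move/cvgryPge : kappay; apply.
rewrite /OLC asboolT; last exact: A_inv.
by rewrite lee_fin -ler_pdivrMl ?invr_gt0// invrK -[leLHS]expRK ler_ln// posrE;
  [exact: expR_gt0|exact: lt_le_trans (expR_gt0 _) kM].
Unshelve. all: by end_near. Qed.
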